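(* Let $G$ be a finite group, $H$ a subgroup of $G$ with $n$ elements, and $A_0$ the $^*$-algebra of all complex functions on $G$ with pointwise operations and coproduct $\Delta_0(f)(p,q)=f(pq)$. Let $E:A_0\to A_0$ be given by $(E(f))(p)=\frac1{n^2}\sum_{h,k\in H}f(hpk)$, and let $A=E(A_0)$ be its range (the $^*$-subalgebra of functions constant on the double cosets $HpH$). Define $\Delta$ on $A$ by $\Delta(f)=(E\otimes\iota)\Delta_0(f)$. Then $(A,\Delta)$ is a finite $^*$-quantum hypergroup.
   Context: $A_0\otimes A_0$ is identified with the functions on $G\times G$; $\iota$ is the identity map. For $f\in A$ the element $(E\otimes\iota)\Delta_0(f)$ belongs to $A\otimes A$ and equals the function $(p,q)\mapsto\frac1n\sum_{k\in H}f(pkq)$. A coproduct on a finite-dimensional unital algebra $A$ over $\mathbb C$ is a linear map $\Delta:A\to A\otimes A$ with $(\Delta\otimes\iota)\Delta=(\iota\otimes\Delta)\Delta$ (not assumed multiplicative). A counit is a linear map $\varepsilon:A\to\mathbb C$ with $(\varepsilon\otimes\iota)\Delta(a)=a=(\iota\otimes\varepsilon)\Delta(a)$ for all $a$. A linear functional $\omega$ on $A$ is faithful if $\omega(ac)=0$ for all $c$ implies $a=0$, and $\omega(ac)=0$ for all $a$ implies $c=0$. A linear functional $\varphi$ on $A$ is a left integral if there is a linear map $S:A\to A$ with $S((\iota\otimes\varphi)(\Delta(a)(1\otimes c)))=(\iota\otimes\varphi)((1\otimes a)\Delta(c))$ for all $a,c\in A$. If $\varphi$ is faithful, $S$ is unique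 and called the antipode of $\varphi$. A finite quantum hypergroup is a pair $(A,\Delta)$ of a finite-dimensional unital algebra $A$ with a coproduct admitting a counit, such that there is a faithful left integral on $A$, $\Delta(1)=1\otimes1$, the counit is an algebra homomorphism, and the antipode of the integral is an anti-isomorphism of the algebra $A$. It is a finite $^*$-quantum hypergroup if moreover $A$ is a $^*$-algebra and $\Delta(a^* )=\Delta(a)^*$ for all $a$. *)

(* Defs.v *)
From HB Require Import structures.
From mathcomp Require Import all_boot all_order all_fingroup all_algebra all_field.

Set Implicit Arguments.
Unset Strict Implicit.
Unset Printing Implicit Defensive.

Import GRing.Theory Num.Theory VectorInternalTheory.

Local Open Scope ring_scope.

Reserved Notation "u ⊗ v" (at level 40, left associativity).
Reserved Notation "S ⊠ T" (at level 40, left associativity).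

(* A model of the tensor product of two finite-dimensional vector spaces:     *)
(* T represents \sum_(i, j) T i j (e_i ⊗ f_j), where e and f are the bases    *)
(* underlying the vectType structures of U and V. The universal property is   *)
(* given by tlift and the lemmas tliftE and tensor_ext.                       *)
Section Tensor.
Variable K : fieldType.

Definition tensor (U V : vectType K) := 'M[K]_(dim U, dim V).

HB.instance Definition _ (U V : vectType K) := Vector.on (tensor U V).

Definition stdbase (U : vectType K) (i : 'I_(dim U)) : U := r2v (delta_mx 0 i).

Definition tens (U V : vectType K) (u : U) (v : V) : tensor U V :=
  (v2r u)^T *m v2r v.

Local Notation "u ⊗ v" := (tens u v).

Definition tlift (U V W : vectType K) (b : U -> V -> W) (T : tensor U V) : W :=
  \sum_i \sum_j T i j *: b (stdbase i) (stdbase j).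

Definition bilinear_map (U V W : vectType K) (b : U -> V -> W) :=
  (forall v, linear (b^~ v)) /\ (forall u, linear (b u)).

Definition tmap (U U' V V' : vectType K) (f : U -> U') (g : V -> V') :
  tensor U V -> tensor U' V' := tlift (fun u v => f u ⊗ g v).

Definition tassoc (U V W : vectType K) :
  tensor (tensor U V) W -> tensor U (tensor V W) :=
  tlift (fun (T : tensor U V) (w : W) => tlift (fun u v => u ⊗ (v ⊗ w)) T).

Definition slicel (U V : vectType K) (w : U -> K) : tensor U V -> V :=
  tlift (fun u v => w u *: v).

Definition slicer (U V : vectType K) (w : V -> K) : tensor U V -> U :=
  tlift (fun u v => w v *: u).

Lemma linear_comb (U W : vectType K) (f : U -> W) (I : finType)
  (k : I -> K) (x : I -> U) :
  linear f -> f (\sum_i k i *: x i) = \sum_i k i *: f (x i).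
Proof.
move=> fl; have f0 : f 0 = 0.
  by apply: (addIr (f 0)); have:= fl 1 0 0; rewrite !scale1r !add0r => <-.
have fD x1 x2 : f (x1 + x2) = f x1 + f x2 by have:= fl 1 x1 x2; rewrite !scale1r.
rewrite (big_morph f fD f0); apply: eq_bigr => i _.
by rewrite -[_ *: _]addr0 fl f0 addr0.
Qed.

Lemma stdbaseE (U : vectType K) (u : U) : u = \sum_i v2r u 0 i *: stdbase i.
Proof.
rewrite -[LHS]v2rK {1}[v2r u]row_sum_delta linear_sum.
by apply: eq_bigr => i _; rewrite linearZ.
Qed.

Section Theory.
Variables U V W : vectType K.

Lemma tlift_is_linear (b : U -> V -> W) : linear (tlift b).
Proof.
move=> a S T; rewrite /tlift scaler_sumr -big_split; apply: eq_bigr => i _ /=.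
rewrite scaler_sumr -big_split; apply: eq_bigr => j _ /=.
by rewrite !mxE scalerDl scalerA.
Qed.

HB.instance Definition _ b := GRing.isSemilinear.Build K (tensor U V) W _
  (tlift b) (GRing.semilinear_linear (tlift_is_linear b)).

Lemma tens_bilinear : bilinear_map (@tens U V).
Proof.
split=> [v a u u' | u a v v']; rewrite /tens linearP.
  by rewrite linearP /= mulmxDl -scalemxAl.
by rewrite mulmxDr -scalemxAr.
Qed.

Lemma tliftE (b : U -> V -> W) : bilinear_map b ->
  forall u v, tlift b (u ⊗ v) = b u v.
Proof.
move=> [bl br] u v; rewrite [in RHS](stdbaseE u) (linear_comb _ _ (bl v)).
apply: eq_bigr => i _; rewrite [in RHS](stdbaseE v) (linear_comb _ _ (br _)).
rewrite scaler_sumr; apply: eq_bigr => j _.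
by rewrite scalerA /tens mxE big_ord1 mxE.
Qed.

Lemma tensorE (T : tensor U V) :
  T = \sum_i \sum_j T i j *: (stdbase i ⊗ stdbase j).
Proof.
rewrite {1}[T]matrix_sum_delta; apply: eq_bigr => i _; apply: eq_bigr => j _.
by rewrite /tens !r2vK trmx_delta mul_delta_mx.
Qed.

Lemma tensor_ext (f g : {linear tensor U V -> W}) :
  (forall u v, f (u ⊗ v) = g (u ⊗ v)) -> f =1 g.
Proof.
move=> fg T; rewrite [T]tensorE !linear_sum; apply: eq_bigr => i _.
rewrite !linear_sum; apply: eq_bigr => j _.
by rewrite !linearZ /= fg.
Qed.

End Theory.

HB.instance Definition _ (U U' V V' : vectType K) (f : U -> U') (g : V -> V') :=
  GRing.Linear.copy (tmap f g) (tlift (fun u v => f u ⊗ g v)).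

Lemma tmapE (U U' V V' : vectType K) (f : {linear U -> U'})
  (g : {linear V -> V'}) u v : tmap f g (u ⊗ v) = f u ⊗ g v.
Proof.
have [tl tr] := tens_bilinear U' V'.
by rewrite /tmap tliftE //; split=> [w | w] a x y; rewrite linearP ?tl ?tr.
Qed.

Lemma tassocE (U V W : vectType K) (u : U) (v : V) (w : W) :
  tassoc ((u ⊗ v) ⊗ w) = u ⊗ (v ⊗ w).
Proof.
have [ul ur] := tens_bilinear U (tensor V W).
have [vl vr] := tens_bilinear V W.
have bil (z : W) : bilinear_map (fun (x : U) (y : V) => x ⊗ (y ⊗ z)).
  by split=> t k x y; [rewrite ul | rewrite vl ur].
rewrite /tassoc tliftE ?tliftE //; split=> [t | T] k x y; first exact: linearP.
rewrite /tlift scaler_sumr -big_split; apply: eq_bigr => i _ /=.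
rewrite scaler_sumr -big_split; apply: eq_bigr => j _ /=.
by rewrite vr ur scalerDr !scalerA mulrC.
Qed.

Lemma slicelE (U V : vectType K) (w : {scalar U}) (u : U) (v : V) :
  slicel w (u ⊗ v) = w u *: v.
Proof.
rewrite /slicel tliftE //; split=> [t | t] k x y.
  by rewrite linearP /= scalerDl scalerA.
by rewrite scalerDr !scalerA mulrC.
Qed.

Lemma slicerE (U V : vectType K) (w : {scalar V}) (u : U) (v : V) :
  slicer w (u ⊗ v) = w v *: u.
Proof.
rewrite /slicer tliftE //; split=> [t | t] k x y.
  by rewrite scalerDr !scalerA mulrC.
by rewrite linearP /= scalerDl scalerA.
Qed.

Definition tmul (A B : falgType K) (S T : tensor A B) : tensor A B :=
  tlift (fun a b => tlift (fun c d => (a * c) ⊗ (b * d)) T) S.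

Local Notation "S ⊠ T" := (tmul S T).

Lemma tmulE (A B : falgType K) (a c : A) (b d : B) :
  (a ⊗ b) ⊠ (c ⊗ d) = (a * c) ⊗ (b * d).
Proof.
have [tl tr] := tens_bilinear A B.
have bil x y : bilinear_map (fun z t => (x * z : A) ⊗ (y * t : B)).
  by split=> [w | w] k u v; rewrite mulrDr -scalerAr ?tl ?tr.
rewrite /tmul tliftE ?tliftE //; split=> [w | w] k u v.
  rewrite /tlift scaler_sumr -big_split; apply: eq_bigr => i _ /=.
  rewrite scaler_sumr -big_split; apply: eq_bigr => j _ /=.
  by rewrite mulrDl -scalerAl tl scalerDr !scalerA mulrC.
rewrite /tlift scaler_sumr -big_split; apply: eq_bigr => i _ /=.
rewrite scaler_sumr -big_split; apply: eq_bigr => j _ /=.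
by rewrite mulrDl -scalerAl tr scalerDr !scalerA mulrC.
Qed.

(* The inclusion of A ⊗ B into U ⊗ V for subspaces A and B is injective, so a *)
(* map Delta : A -> A ⊗ A may be specified by its values in U ⊗ U.            *)
Lemma tmap_vsval_inj (U V : vectType K) (A : {vspace U}) (B : {vspace V}) :
  injective (tmap (@vsval _ _ A) (@vsval _ _ B)).
Proof.
apply: (@can_inj _ _ _ (tmap (vsproj A) (vsproj B))).
apply: (tensor_ext (f := tmap (vsproj A) (vsproj B) \o tmap vsval vsval)
  (g := idfun)) => u v /=.
by rewrite !tmapE /= !vsvalK.
Qed.

End Tensor.

Notation "u ⊗ v" := (tens u v) : ring_scope.
Notation "S ⊠ T" := (tmul S T) : ring_scope.

Section Hypergroup.
Variables (K : fieldType) (A : falgType K).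
Implicit Types (Delta : {linear A -> tensor A A}) (phi eps : {scalar A}).

Definition coassociative Delta := forall a,
  tassoc (tmap Delta idfun (Delta a)) = tmap idfun Delta (Delta a).

Definition counit Delta eps := forall a,
  slicel eps (Delta a) = a /\ slicer eps (Delta a) = a.

Definition faithful (w : {scalar A}) :=
  (forall a, (forall c, w (a * c) = 0) -> a = 0) /\
  (forall c, (forall a, w (a * c) = 0) -> c = 0).

Definition antipode_for Delta phi (S : {linear A -> A}) := forall a c,
  S (slicer phi (Delta a ⊠ (1 ⊗ c))) = slicer phi ((1 ⊗ a) ⊠ Delta c).

Definition left_integral Delta phi :=
  exists S : {linear A -> A}, antipode_for Delta phi S.

Definition anti_isomorphism (S : {linear A -> A}) :=
  bijective S /\ forall a b, S (a * b) = S b * S a.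

(* The counit, and the antipode of a given faithful left integral, are unique *)
(* when they exist, so the existential quantifiers over eps and S speak of    *)
(* the counit and the antipode.                                               *)
Definition finite_quantum_hypergroup Delta := [/\
  coassociative Delta,
  exists eps, counit Delta eps /\ monoid_morphism eps,
  Delta 1 = 1 ⊗ 1 &
  exists phi, [/\ left_integral Delta phi, faithful phi &
    exists S, antipode_for Delta phi S /\ anti_isomorphism S]].

End Hypergroup.

Section StarHypergroup.
Variables (C : numClosedFieldType) (A : falgType C).
Implicit Types (Delta : {linear A -> tensor A A}) (star : A -> A).

Definition star_operation star := [/\
  forall k a b, star (k *: a + b) = k^* *: star a + star b,
  forall a b, star (a * b) = star b * star a &
  involutive star].

Definition tstar star (T : tensor A A) : tensor A A :=
  tlift (fun a b => star a ⊗ star b) (map_mx Num.conj T).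

Lemma tstarE star a b : star_operation star ->
  tstar star (a ⊗ b) = star a ⊗ star b.
Proof.
case=> starL _ _; have [tl tr] := tens_bilinear A A.
have starD x y : star (x + y) = star x + star y.
  by rewrite -[x in LHS]scale1r starL rmorph1 scale1r.
have star0 : star 0 = 0 by apply: (addrI (star 0)); rewrite -starD !addr0.
have starZ k x : star (k *: x) = k^* *: star x.
  by rewrite -[k *: x]addr0 starL star0 addr0.
have starS n (F : 'I_n -> A) : star (\sum_i F i) = \sum_i star (F i).
  exact: (big_morph star starD star0).
have sE x : star x = \sum_i (v2r x 0 i)^* *: star (stdbase i).
  rewrite [in LHS](stdbaseE x) starS.
  by apply: eq_bigr => i _; rewrite starZ.
rewrite (sE a) (sE b).
rewrite (linear_comb _ _ (tl _)).
apply: eq_bigr => i _; rewrite (linear_comb _ _ (tr _)) scaler_sumr.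
apply: eq_bigr => j _.
by rewrite scalerA !mxE big_ord1 !mxE rmorphM.
Qed.

Definition finite_star_quantum_hypergroup Delta star := [/\
  finite_quantum_hypergroup Delta,
  star_operation star &
  forall a, Delta (star a) = tstar star (Delta a)].

End StarHypergroup.

Section GroupFunctions.
Variables (C : numClosedFieldType) (gT : finGroupType).

(* C^o is C seen as a vector space over itself. *)
Definition gfun := {ffun gT -> C^o}.

HB.instance Definition _ := Vector.on gfun.
HB.instance Definition _ := GRing.PzRing.on gfun.

Fact gfun1_neq0 : (1 : gfun) != 0.
Proof. exact: (ffun1_nonzero C^o 1%g). Qed.

HB.instance Definition _ := GRing.PzSemiRing_isNonZero.Build gfun gfun1_neq0.

Fact gfun_scaleAl (k : C) (f g : gfun) : k *: (f * g) = k *: f * g.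
Proof. by apply/ffunP=> p; rewrite !ffunE scalerAl. Qed.

HB.instance Definition _ :=
  GRing.LSemiModule_isLSemiAlgebra.Build C gfun gfun_scaleAl.

Fact gfun_scaleAr (k : C) (f g : gfun) : k *: (f * g) = f * (k *: g).
Proof. by apply/ffunP=> p; rewrite !ffunE scalerAr. Qed.

HB.instance Definition _ :=
  GRing.LSemiAlgebra_isSemiAlgebra.Build C gfun gfun_scaleAr.

HB.instance Definition _ := Algebra_isFalgebra.Build C gfun.

Definition gdelta (p : gT) : gfun := [ffun q => (q == p)%:R].

(* The identification of gfun ⊗ gfun with the functions on gT x gT, under     *)
(* which f ⊗ g is the function (p, q) |-> f p * g q, and its inverse          *)
Definition tensor_to_fun : tensor gfun gfun -> {ffun gT * gT -> C^o} :=
  tlift (fun f g : gfun => [ffun pq => f pq.1 * g pq.2]).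

Definition fun_to_tensor (F : {ffun gT * gT -> C^o}) : tensor gfun gfun :=
  \sum_p \sum_q F (p, q) *: (gdelta p ⊗ gdelta q).

HB.instance Definition _ := GRing.Linear.copy tensor_to_fun
  (tlift (fun f g : gfun => [ffun pq => f pq.1 * g pq.2])).

Lemma tensor_to_funE f g p q : tensor_to_fun (f ⊗ g) (p, q) = f p * g q.
Proof.
rewrite /tensor_to_fun tliftE ?ffunE //.
split=> [v | u] k x y; apply/ffunP=> pq; rewrite !ffunE /=.
  by rewrite mulrDl scalerAl.
by rewrite mulrDr scalerAr.
Qed.

Lemma gfun_sum_delta (f : gfun) : f = \sum_p f p *: gdelta p.
Proof.
apply/ffunP=> q; rewrite sum_ffunE (bigD1 q) //= !ffunE eqxx.
rewrite [X in _ + X]big1 ?addr0 => [|p /negPf qp].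
  by rewrite [RHS]mulr1.
by rewrite !ffunE eq_sym qp scaler0.
Qed.

Fact fun_to_tensor_is_linear : linear fun_to_tensor.
Proof.
move=> a F F'; rewrite /fun_to_tensor scaler_sumr -big_split.
apply: eq_bigr => p _; rewrite scaler_sumr -big_split; apply: eq_bigr => q _.
by rewrite !ffunE scalerDl scalerA.
Qed.

HB.instance Definition _ := GRing.isSemilinear.Build C _ _ _ fun_to_tensor
  (GRing.semilinear_linear fun_to_tensor_is_linear).

Lemma fun_to_tensorK : cancel fun_to_tensor tensor_to_fun.
Proof.
move=> F; apply/ffunP=> -[p q]; rewrite linear_sum sum_ffunE (bigD1 p) //=.
rewrite linear_sum sum_ffunE (bigD1 q) //= linearZ ffunE tensor_to_funE.
rewrite !ffunE !eqxx mulr1 [_ *: _]mulr1 !big1 ?addr0 // => [p' | q'] np.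
  rewrite linear_sum sum_ffunE big1 // => q' _.
  by rewrite linearZ ffunE tensor_to_funE !ffunE eq_sym (negPf np) mul0r scaler0.
rewrite linearZ ffunE tensor_to_funE !ffunE [q == _]eq_sym (negPf np) mulr0.
by rewrite scaler0.
Qed.

Lemma tensor_to_funK : cancel tensor_to_fun fun_to_tensor.
Proof.
have [tl tr] := tens_bilinear gfun gfun.
apply: (tensor_ext (f := fun_to_tensor \o tensor_to_fun) (g := idfun)) => f g.
rewrite /= [in RHS](gfun_sum_delta f) (linear_comb _ _ (tl _)).
apply: eq_bigr => p _.
rewrite [in RHS](gfun_sum_delta g) (linear_comb _ _ (tr _)) scaler_sumr.
by apply: eq_bigr => q _; rewrite scalerA tensor_to_funE.
Qed.

Definition gcoprod (f : gfun) : tensor gfun gfun :=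
  fun_to_tensor [ffun pq => f (pq.1 * pq.2)%g].

Definition gstar (f : gfun) : gfun := [ffun p => (f p)^*].

Variable H : {group gT}.

Definition dcavg (f : gfun) : gfun :=
  [ffun p => (#|H|%:R ^+ 2)^-1 * \sum_(h in H) \sum_(k in H) f (h * p * k)%g].

Fact dcavg_is_linear : linear dcavg.
Proof.
move=> a f g; apply/ffunP=> p; rewrite !ffunE scalerAr -mulrDr; congr (_ * _).
rewrite scaler_sumr -big_split; apply: eq_bigr => h _ /=.
by rewrite scaler_sumr -big_split; apply: eq_bigr => k _ /=; rewrite !ffunE.
Qed.

HB.instance Definition _ := GRing.isSemilinear.Build C gfun gfun _ dcavg
  (GRing.semilinear_linear dcavg_is_linear).

Definition dcalg : {vspace gfun} := limg (linfun dcavg).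

Lemma mem_dcalg (f : gfun) : reflect
  (forall h k p, h \in H -> k \in H -> f (h * p * k)%g = f p) (f \in dcalg).
Proof.
have HH : #|H|%:R != 0 :> C by rewrite pnatr_eq0 -lt0n cardG_gt0.
apply: (iffP memv_imgP) => [[g _ ->] h k p Hh Hk | fH].
  rewrite lfunE !ffunE; congr (_ * _).
  rewrite (reindex_inj (mulIg h^-1%g)) /=; apply: eq_big => [x | x Hx].
    by rewrite groupMr ?groupV.
  rewrite (reindex_inj (mulgI k^-1%g)) /=; apply: eq_big => [y | y Hy].
    by rewrite groupMl ?groupV.
  by rewrite !mulgA mulgKV mulgK.
exists f; rewrite ?memvf // lfunE; apply/ffunP=> p; rewrite !ffunE.
rewrite (eq_bigr (fun=> #|H|%:R * f p)) => [|h Hh].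
  by rewrite sumr_const -[X in _ * X]mulr_natl [X in _ * X]mulrA -expr2 mulKf ?expf_neq0.
by rewrite (eq_bigr (fun=> f p)) ?sumr_const ?mulr_natl // => k Hk; rewrite fH.
Qed.

Lemma dcalg_gstar f : f \in dcalg -> gstar f \in dcalg.
Proof. by move/mem_dcalg=> fH; apply/mem_dcalg=> h k p Hh Hk; rewrite !ffunE fH. Qed.

Fact dcalg_is_aspace : is_aspace dcalg.
Proof.
rewrite /is_aspace has_algid1; last by apply/mem_dcalg=> h k p _ _; rewrite !ffunE.
apply/prodvP=> f g /mem_dcalg fH /mem_dcalg gH.
by apply/mem_dcalg=> h k p Hh Hk; rewrite !ffunE fH ?gH.
Qed.

Canonical dcalg_aspace : {aspace gfun} := ASpace dcalg_is_aspace.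

Definition dcstar (f : subvs_of dcalg) : subvs_of dcalg :=
  Subvs (dcalg_gstar (valP f)).

End GroupFunctions.

(* Main.v *)
(* An element of A ⊗ A is determined by its values as a function on G x G,    *)
(* and products, slices and the involution are computed on these values.      *)
(* For f constant on double cosets, Delta f is the function                   *)
(* (p, q) |-> n^-1 \sum_(k in H) f (p k q). Its first leg is averaged by E,   *)
(* its second leg is already H-invariant since k runs over all of H, so it    *)
(* lies in A ⊗ A. The counit is evaluation at 1, the integral is summation    *)
(* over G, and translating the summation variable by k and by p shows that    *)
(* the antipode is f |-> (p |-> f (p^-1)).                                    *)

Require Import Defs.
From HB Require Import structures.
From mathcomp Require Import all_boot all_order all_fingroup all_algebra all_field.
From mathcomp Require Import complex reals.

Set Implicit Arguments.
Unset Strict Implicit.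
Unset Printing Implicit Defensive.

Import GRing.Theory Num.Theory VectorInternalTheory.

Local Open Scope ring_scope.

(** Everything reduces to averages over [H] of values of double-coset functions on products in the
    group. Point evaluations separate [A] ([dcvalP]) and pairs of them separate [A ⊗ A] ([tvalP]),
    so each axiom becomes an identity between complex numbers once [tval_dccoprod] gives the
    coproduct at (p, q) as the mean over k in [H] of f(pkq). Coassociativity holds because both
    sides are the double mean of f(pkqlr) over k, l in [H]. At p = 1 or q = 1 the averaging element
    is absorbed by invariance, so evaluation at 1 is a counit; it is multiplicative, and the unit
    and involution are handled pointwise. Summation over the group is faithful by positivity of the
    sum of |f(p)|^2 ([haar_faithful]), and translation invariance of that sum makes group inversion
    its antipode ([dcinv_antipode]). Since [A] is commutative, this involutive homomorphism is also
    an anti-isomorphism. *)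

HB.instance Definition _ (K : fieldType) (U V : vectType K) (w : U -> K) :=
  GRing.Linear.copy (@slicel K U V w) (tlift (fun u v => w u *: v)).

HB.instance Definition _ (K : fieldType) (U V : vectType K) (w : V -> K) :=
  GRing.Linear.copy (@slicer K U V w) (tlift (fun u v => w v *: u)).

HB.instance Definition _ (K : fieldType) (U V W : vectType K) :=
  GRing.Linear.copy (@tassoc K U V W)
    (tlift (fun (T : tensor U V) (w : W) => tlift (fun u v => u ⊗ (v ⊗ w)) T)).

(** * Slice maps and separation of tensors *)

Section Tensors.
Variable K : fieldType.

Lemma tensor_ind (U V : vectType K) (P : tensor U V -> Prop) :
  (forall u v, P (u ⊗ v)) -> (forall k S T, P S -> P T -> P (k *: S + T)) ->
  forall T, P T.
Proof.
move=> Ptens Plin T.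
have P0 : P 0 by have := Plin (-1) _ _ (Ptens 0 0) (Ptens 0 0); rewrite scaleN1r addNr.
have PD S S' : P S -> P S' -> P (S + S').
  by move=> PS PS'; rewrite -[S]scale1r; apply: Plin.
rewrite [T]tensorE; apply: (big_ind P) => // i _.
by apply: (big_ind P) => // j _; rewrite -[_ *: _]addr0; apply: Plin.
Qed.

Lemma slicel_tmapr (U V V' : vectType K) (w : {scalar U}) (g : {linear V -> V'})
    (T : tensor U V) : slicel w (tmap idfun g T) = g (slicel w T).
Proof.
elim/tensor_ind: T => [u v | k S T IHS IHT]; first by rewrite tmapE !slicelE linearZ.
by rewrite !linearP /= IHS IHT.
Qed.

Lemma tensZl (U V : vectType K) (k : K) (u : U) (v : V) :
  (k *: u) ⊗ v = k *: (u ⊗ v).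
Proof. by rewrite /tens !linearZ -scalemxAl. Qed.

Lemma tmul_linearr (A B : falgType K) (S : tensor A B) : linear (tmul S).
Proof.
have tmulT T : S ⊠ T = \sum_i \sum_j S i j *:
    tlift (fun c d => (stdbase i * c) ⊗ (stdbase j * d)) T by [].
move=> k T T'; rewrite !tmulT scaler_sumr -big_split; apply: eq_bigr => i _ /=.
rewrite scaler_sumr -big_split; apply: eq_bigr => j _ /=.
by rewrite scalerA mulrC -scalerA -scalerDr linearP.
Qed.

Lemma tmul_linearl (A B : falgType K) (T : tensor A B) : linear (fun S => S ⊠ T).
Proof. by move=> k S S'; rewrite /tmul linearP. Qed.

(** Together with [slicel_tmapr], this brings coassociativity down from a triple tensor product to
    [A ⊗ A], where [tvalP] applies. *)
Lemma slicel_tassoc (U V W : vectType K) (w : {scalar U})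
    (T : tensor (tensor U V) W) :
  slicel w (tassoc T) = tmap (slicel w) idfun T.
Proof.
have [tl _] := tens_bilinear (tensor U V) W.
have [tl' _] := tens_bilinear V W.
elim/tensor_ind: T => [X c | k S T IHS IHT]; last by rewrite !linearP /= IHS IHT.
rewrite tmapE; elim/tensor_ind: X => [u v | k S T IHS IHT].
  by rewrite tassocE slicelE /= slicelE tensZl.
by rewrite tl !linearP /= IHS IHT tl'.
Qed.

Lemma slicel_slicer (U V : vectType K) (w : {scalar U}) (x : {scalar V})
    (T : tensor U V) : x (slicel w T) = w (slicer x T).
Proof.
elim/tensor_ind: T => [u v | k S T IHS IHT]; last by rewrite !linearP /= IHS IHT.
by rewrite slicelE slicerE !linearZ /= mulrC.
Qed.

Definition stdcoord (V : vectType K) (j : 'I_(dim V)) (v : V) : K := v2r v 0 j.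

Lemma stdcoord_is_linear (V : vectType K) (j : 'I_(dim V)) : scalar (stdcoord j).
Proof. by move=> k u v; rewrite /stdcoord linearP !mxE. Qed.

HB.instance Definition _ (V : vectType K) (j : 'I_(dim V)) :=
  GRing.isSemilinear.Build K V K _ (stdcoord j)
    (GRing.semilinear_linear (stdcoord_is_linear j)).

Lemma stdcoord_slicer (U V : vectType K) (T : tensor U V) i j :
  stdcoord i (slicer (stdcoord j) T) = T i j.
Proof.
elim/tensor_ind: T => [u v | k S T IHS IHT].
  by rewrite slicerE linearZ /= mulrC [RHS]mxE big_ord1 mxE.
by rewrite !linearP /= IHS IHT !mxE.
Qed.

(** Slicing the two legs in either order gives the same scalar, so the hypothesis on [w] forces all
    coordinate slices of the second leg to agree, and these determine every matrix entry. *)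
Lemma slicel_separating (U V : vectType K) (I : Type) (w : I -> {scalar U}) :
  (forall u u', (forall i, w i u = w i u') -> u = u') ->
  forall S T : tensor U V, (forall i, slicel (w i) S = slicel (w i) T) -> S = T.
Proof.
move=> sep S T eqST; apply/matrixP => i j; rewrite -!stdcoord_slicer.
by congr (stdcoord i _); apply: sep => l; rewrite -!slicel_slicer eqST.
Qed.

Lemma slicel_tmapl (U U' V : vectType K) (w : {scalar U'}) (g : {linear U -> U'})
    (T : tensor U V) : slicel w (tmap g idfun T) = slicel (w \o g) T.
Proof.
elim/tensor_ind: T => [u v | k S T IHS IHT]; first by rewrite tmapE !slicelE.
by rewrite !linearP /= IHS IHT.
Qed.

End Tensors.

Section GroupFunctions.
Variables (C : numClosedFieldType) (gT : finGroupType).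

Lemma gcoprod_is_linear : linear (@gcoprod C gT).
Proof.
move=> k f g; rewrite /gcoprod -linearP; congr (fun_to_tensor _).
by apply/ffunP=> pq; rewrite !ffunE.
Qed.

HB.instance Definition _ := GRing.isSemilinear.Build C (gfun C gT) _ _
  (@gcoprod C gT) (GRing.semilinear_linear gcoprod_is_linear).

Lemma tensor_to_fun_gcoprod (f : gfun C gT) p q :
  tensor_to_fun (gcoprod f) (p, q) = f (p * q)%g.
Proof. by rewrite /gcoprod fun_to_tensorK ffunE. Qed.

End GroupFunctions.

(** * Point evaluations on the algebra of double-coset functions *)

Section DoubleCosets.
Variables (C : numClosedFieldType) (gT : finGroupType) (H : {group gT}).
Local Notation A := (subvs_of (dcalg C H)).
Implicit Types (a b f : A) (T : tensor A A) (p q r h k : gT).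

Definition dcval p a : C := vsval a p.

Lemma dcval_is_linear p : scalar (dcval p).
Proof. by move=> k a b; rewrite /dcval linearP !ffunE. Qed.

HB.instance Definition _ p := GRing.isSemilinear.Build C A C _ (dcval p)
  (GRing.semilinear_linear (dcval_is_linear p)).

Lemma dcvalP a b : (forall p, dcval p a = dcval p b) -> a = b.
Proof. by move=> eqab; apply/val_inj/ffunP => p; apply: eqab. Qed.

Lemma dcvalH h k p a : h \in H -> k \in H -> dcval (h * p * k)%g a = dcval p a.
Proof. by move: h k p; apply/mem_dcalg/(valP a). Qed.

Lemma dcvalHl h p a : h \in H -> dcval (h * p)%g a = dcval p a.
Proof. by move=> Hh; rewrite -[(h * p)%g]mulg1 dcvalH. Qed.

Lemma dcvalHr k p a : k \in H -> dcval (p * k)%g a = dcval p a.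
Proof. by move=> Hk; rewrite -[p in (p * k)%g]mul1g dcvalH. Qed.

Lemma dcvalM p a b : dcval p (a * b) = dcval p a * dcval p b.
Proof. by rewrite /dcval ffunE. Qed.

Lemma dcval1 p : dcval p 1 = 1.
Proof.
(* The unit of [subvs_of] is [algid]; it is the constant function 1 because that function lies in
   the subspace. *)
have /eqP e1 : algid (dcalg_aspace C H) == 1.
  by rewrite algid_eq1; apply/mem_dcalg => h k q _ _; rewrite !ffunE.
by rewrite /dcval /= e1 ffunE.
Qed.

Lemma dcmulC a b : a * b = b * a.
Proof. by apply: dcvalP => p; rewrite !dcvalM mulrC. Qed.

Lemma dcval_star p a : dcval p (dcstar a) = (dcval p a)^*.
Proof. by rewrite /dcval ffunE. Qed.

(** * Two-variable evaluations on the tensor square *)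

Definition tval p q T : C := tensor_to_fun (tmap vsval vsval T) (p, q).

Lemma tval_is_linear p q : scalar (tval p q).
Proof. by move=> k S T; rewrite /tval !linearP !ffunE. Qed.

HB.instance Definition _ p q := GRing.isSemilinear.Build C (tensor A A) C _ (tval p q)
  (GRing.semilinear_linear (tval_is_linear p q)).

Lemma tval_tens p q a b : tval p q (a ⊗ b) = dcval p a * dcval q b.
Proof. by rewrite /tval tmapE tensor_to_funE. Qed.

Lemma tvalP S T : (forall p q, tval p q S = tval p q T) -> S = T.
Proof.
move=> eqST; apply: (@tmap_vsval_inj _ _ _ (dcalg C H) (dcalg C H)).
apply: (can_inj (@tensor_to_funK C gT)).
by apply/ffunP => -[p q]; apply: eqST.
Qed.

Lemma tval_slicel p q T : dcval q (slicel (dcval p) T) = tval p q T.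
Proof.
elim/tensor_ind: T => [a b | k S T IHS IHT]; last by rewrite !linearP /= IHS IHT.
by rewrite slicelE tval_tens linearZ.
Qed.

Lemma tval_slicer p q T : dcval p (slicer (dcval q) T) = tval p q T.
Proof.
elim/tensor_ind: T => [a b | k S T IHS IHT]; last by rewrite !linearP /= IHS IHT.
by rewrite slicerE tval_tens linearZ mulrC.
Qed.

Lemma tval_tmul p q S T : tval p q (S ⊠ T) = tval p q S * tval p q T.
Proof.
elim/tensor_ind: S => [a b | k S S' IHS IHS']; last first.
  by rewrite tmul_linearl !linearP mulrDl -mulrA /= IHS IHS'.
elim/tensor_ind: T => [c d | k T T' IHT IHT']; last first.
  by rewrite tmul_linearr !linearP mulrDr mulrCA /= IHT IHT'.
by rewrite tmulE !tval_tens !dcvalM mulrACA.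
Qed.

Lemma tval_tstar p q T : tval p q (tstar (@dcstar C gT H) T) = (tval p q T)^*.
Proof.
rewrite /tstar /tlift [in RHS](tensorE T) !linear_sum.
rewrite rmorph_sum; apply: eq_bigr => i _; rewrite !linear_sum rmorph_sum.
by apply: eq_bigr => j _ /=; rewrite mxE !linearZ /= !tval_tens rmorphM rmorphM !dcval_star.
Qed.

Lemma card_group_neq0 : #|H|%:R != 0 :> C.
Proof. by rewrite pnatr_eq0 -lt0n cardG_gt0. Qed.

(** * The coproduct and its values *)

Definition dcproj : gfun C gT -> A := vsproj (dcalg C H) \o @dcavg C gT H.

HB.instance Definition _ := GRing.Linear.on dcproj.

Lemma vsval_dcproj (f : gfun C gT) : vsval (dcproj f) = dcavg H f.
Proof.
by apply: vsprojK; apply/memv_imgP; exists f; rewrite ?memvf ?lfunE.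
Qed.

(** On functions of two variables, a tensor product of operators acts one variable at a time: [v] in
    the second, then [u] in the first. *)
Lemma tensor_to_fun_tmap (u v : {linear gfun C gT -> gfun C gT})
    (T : tensor (gfun C gT) (gfun C gT)) p q :
  tensor_to_fun (tmap u v T) (p, q) =
  u [ffun x => v [ffun y => tensor_to_fun T (x, y)] q] p.
Proof.
elim/tensor_ind: T => [f g | k S T IHS IHT].
  rewrite tmapE tensor_to_funE.
  have -> : [ffun x => v [ffun y => tensor_to_fun (f ⊗ g) (x, y)] q] =
            v g q *: f :> gfun C gT.
    apply/ffunP => x; rewrite !ffunE.
    have -> : [ffun y => tensor_to_fun (f ⊗ g) (x, y)] = f x *: g :> gfun C gT.
      by apply/ffunP => y; rewrite ffunE tensor_to_funE ffunE.
    by rewrite linearZ ffunE; apply: mulrC.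
  by rewrite linearZ ffunE; apply: mulrC.
rewrite linearP linearP !ffunE IHS IHT.
have -> : [ffun x => v [ffun y => tensor_to_fun (k *: S + T) (x, y)] q] =
   k *: [ffun x => v [ffun y => tensor_to_fun S (x, y)] q] +
        [ffun x => v [ffun y => tensor_to_fun T (x, y)] q] :> gfun C gT.
  apply/ffunP => x; rewrite !ffunE.
  have -> : [ffun y => tensor_to_fun (k *: S + T) (x, y)] =
     k *: [ffun y => tensor_to_fun S (x, y)] +
          [ffun y => tensor_to_fun T (x, y)] :> gfun C gT.
    by apply/ffunP => y; rewrite !ffunE linearP !ffunE.
  by rewrite linearP !ffunE.
by rewrite linearP !ffunE.
Qed.

(** Projecting both legs makes the result land in [A ⊗ A] by construction; [vsval_dccoprod] shows
    that the second averaging changes nothing. *)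
Definition dccoprod : A -> tensor A A := tmap dcproj dcproj \o @gcoprod C gT \o vsval.

HB.instance Definition _ := GRing.Linear.on dccoprod.

Lemma tmap_dcavg_gcoprod a p q :
  tensor_to_fun (tmap (@dcavg C gT H) idfun (gcoprod (vsval a))) (p, q) =
  #|H|%:R^-1 * \sum_(k in H) dcval (p * k * q)%g a.
Proof.
rewrite tensor_to_fun_tmap !ffunE expr2 invfM -!mulrA; congr (_ * _).
(* For fixed k, left invariance makes the sum over h constant, which cancels one of the two factors
   1/n. *)
rewrite exchange_big mulr_sumr; apply: eq_bigr => k Hk /=.
rewrite (eq_bigr (fun=> dcval (p * k * q)%g a)).
  by rewrite sumr_const -[X in _ * X]mulr_natl mulKf ?card_group_neq0.
by move=> h Hh; rewrite !ffunE /= tensor_to_fun_gcoprod -!mulgA -/(dcval _ a) dcvalHl.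
Qed.

Lemma vsval_dccoprod a :
  tmap vsval vsval (dccoprod a) = tmap (@dcavg C gT H) idfun (gcoprod (vsval a)).
Proof.
have -> : tmap vsval vsval (dccoprod a) =
          tmap idfun (@dcavg C gT H) (tmap (@dcavg C gT H) idfun (gcoprod (vsval a))).
  rewrite /dccoprod /=.
  elim/tensor_ind: (gcoprod _) => [f g | k S T IHS IHT].
    by rewrite !tmapE /= !vsval_dcproj.
  by rewrite !linearP /= IHS IHT.
apply: (can_inj (@tensor_to_funK C gT)); apply/ffunP => -[p q].
rewrite tensor_to_fun_tmap ffunE /= ffunE.
rewrite (eq_bigr (fun=> \sum_(k in H) tensor_to_fun
    (tmap (@dcavg C gT H) idfun (gcoprod (vsval a))) (p, q))) => [|h Hh].
  rewrite !sumr_const -mulrnA -[X in _ * X]mulr_natl natrM -expr2 mulKf //.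
  by rewrite expf_neq0 ?card_group_neq0.
apply: eq_bigr => k Hk; rewrite ffunE !tmap_dcavg_gcoprod; congr (_ * _).
(* The left translate of q by h is absorbed by the mean over [H] already present in the first leg;
   right invariance of [a] removes k. *)
rewrite (reindex_inj (mulIg h^-1%g)) /=; apply: eq_big => [x | x Hx].
  by rewrite groupMr ?groupV.
by rewrite !mulgA mulgKV (dcvalHr _ _ Hk).
Qed.

Lemma tval_dccoprod p q a :
  tval p q (dccoprod a) = #|H|%:R^-1 * \sum_(k in H) dcval (p * k * q)%g a.
Proof. by rewrite /tval vsval_dccoprod tmap_dcavg_gcoprod. Qed.

Lemma Havg_const (F : gT -> C) c :
  (forall k, k \in H -> F k = c) -> #|H|%:R^-1 * \sum_(k in H) F k = c.
Proof.
by move=> Fc; rewrite (eq_bigr _ Fc) sumr_const -[c *+ _]mulr_natl mulKf ?card_group_neq0.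
Qed.

(** * Coassociativity and counit *)

Lemma dccoprod_coassoc : coassociative dccoprod.
Proof.
move=> a; apply: (slicel_separating dcvalP) => p.
rewrite slicel_tassoc slicel_tmapr; apply: tvalP => q r.
(* On the left the last leg is sliced at r before the inner coproduct is evaluated at (p, q); on the
   right the first leg is sliced at p. *)
rewrite -tval_slicel !slicel_tmapl slicel_slicer /= tval_slicel !tval_dccoprod.
congr (_ * _).
under eq_bigr => k _ do rewrite tval_slicer tval_dccoprod.
under [RHS]eq_bigr => l _ do rewrite tval_slicel tval_dccoprod.
rewrite -!mulr_sumr exchange_big; congr (_ * _).
by apply: eq_bigr => k _; apply: eq_bigr => l _; rewrite !mulgA.
Qed.

Lemma dccoprod_counit : counit dccoprod (dcval 1).
Proof.
move=> a; split; apply: dcvalP => p.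
  rewrite tval_slicel tval_dccoprod; apply: Havg_const => k Hk.
  by rewrite mul1g dcvalHl.
rewrite tval_slicer tval_dccoprod; apply: Havg_const => k Hk.
by rewrite mulg1 dcvalHr.
Qed.

(** * Integral and antipode *)

Definition haar a : C := \sum_p dcval p a.

Lemma haar_is_linear : scalar haar.
Proof.
by move=> k a b; rewrite /haar mulr_sumr -big_split; apply: eq_bigr => p _; rewrite linearP.
Qed.

HB.instance Definition _ := GRing.isSemilinear.Build C A C _ haar
  (GRing.semilinear_linear haar_is_linear).

Lemma haar_faithful : Defs.faithful haar.
Proof.
have haar0 a : (forall c, haar (a * c) = 0) -> a = 0.
  (* Testing against the conjugate of [a] gives a vanishing sum of squared moduli. *)
  move=> /(_ (dcstar a)) a0; apply: dcvalP => p; rewrite linear0.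
  have := a0; rewrite /haar.
  under eq_bigr => q _ do rewrite dcvalM dcval_star -normCK.
  move/psumr_eq0P => /(_ (fun q _ => exprn_ge0 2 (normr_ge0 _)) p isT).
  by move/eqP; rewrite sqrf_eq0 normr_eq0 => /eqP.
by split=> // c c0; apply: haar0 => a; rewrite dcmulC.
Qed.

Lemma dcinv_subproof a : [ffun p => vsval a p^-1%g] \in dcalg C H.
Proof.
apply/mem_dcalg => h k p Hh Hk; rewrite !ffunE -!/(dcval _ a).
by rewrite !invMg mulgA dcvalH ?groupV.
Qed.

Definition dcinv a : A := Subvs (dcinv_subproof a).

Lemma dcval_dcinv p a : dcval p (dcinv a) = dcval p^-1%g a.
Proof. by rewrite /dcval ffunE. Qed.

Lemma dcinv_is_linear : linear dcinv.
Proof. by move=> k a b; apply: dcvalP => p; rewrite dcval_dcinv !linearP /= !dcval_dcinv. Qed.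

HB.instance Definition _ := GRing.isSemilinear.Build C A A _ dcinv
  (GRing.semilinear_linear dcinv_is_linear).

Lemma dcval_slicer_haar p T : dcval p (slicer haar T) = \sum_q tval p q T.
Proof.
elim/tensor_ind: T => [a b | k S T IHS IHT].
  rewrite slicerE linearZ /= mulr_suml; apply: eq_bigr => q _.
  by rewrite tval_tens mulrC.
rewrite !linearP /= IHS IHT mulr_sumr -big_split.
by apply: eq_bigr => q _; rewrite linearP.
Qed.

Lemma dcinv_antipode : antipode_for dccoprod haar dcinv.
Proof.
move=> a c; apply: dcvalP => p; rewrite dcval_dcinv !dcval_slicer_haar.
(* Both sides equal this convolution-type sum: q is translated by k on the left side, by pk on the
   right side, and the k that remains is absorbed by [c] or [a] respectively. *)
transitivity (\sum_q dcval (p^-1 * q)%g a * dcval q c).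
  under eq_bigr => q _ do
    rewrite tval_tmul tval_dccoprod tval_tens dcval1 mul1r -mulrA mulr_suml.
  rewrite -mulr_sumr exchange_big; apply: Havg_const => k Hk /=.
  rewrite (reindex_inj (mulgI k^-1%g)) /=; apply: eq_bigr => q _.
  by rewrite -!mulgA mulKVg (dcvalHl _ _ (groupVr Hk)).
under [RHS]eq_bigr => q _ do
  rewrite tval_tmul tval_dccoprod tval_tens dcval1 mul1r mulrCA mulr_sumr.
rewrite -mulr_sumr exchange_big; apply/esym/Havg_const => k Hk /=.
rewrite (reindex_inj (mulgI (p * k)^-1%g)) /=; apply: eq_bigr => q _.
by rewrite mulKVg invMg -mulgA dcvalHl ?groupV.
Qed.

Lemma dcinv_anti : anti_isomorphism dcinv.
Proof.
split; last by move=> a b; apply: dcvalP => p; rewrite dcmulC !(dcvalM, dcval_dcinv).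
by exists dcinv => a; apply: dcvalP => p; rewrite !dcval_dcinv invgK.
Qed.

(** * Involution, unit and conclusion *)

Lemma dcstar_star : star_operation (@dcstar C gT H).
Proof.
split=> [k a b | a b | a]; apply: dcvalP => p.
- by rewrite dcval_star !linearP /= rmorphD rmorphM !dcval_star.
- by rewrite dcmulC !(dcvalM, dcval_star) rmorphM.
by rewrite !dcval_star conjCK.
Qed.

Lemma dccoprod_star a : dccoprod (dcstar a) = tstar (@dcstar C gT H) (dccoprod a).
Proof.
apply: tvalP => p q; rewrite tval_tstar !tval_dccoprod rmorphM fmorphV rmorph_nat.
by rewrite rmorph_sum; congr (_ * _); apply: eq_bigr => k _; rewrite dcval_star.
Qed.

Lemma dccoprod1 : dccoprod 1 = 1 ⊗ 1.
Proof.
apply: tvalP => p q; rewrite tval_dccoprod tval_tens !dcval1 mulr1.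
by apply: Havg_const => k _; rewrite dcval1.
Qed.

Lemma dccoprod_finite_star_quantum_hypergroup :
  finite_star_quantum_hypergroup dccoprod (@dcstar C gT H).
Proof.
split; [| exact: dcstar_star | exact: dccoprod_star].
split; [exact: dccoprod_coassoc | | exact: dccoprod1 |].
  exists (dcval 1); split; first exact: dccoprod_counit.
  by split=> [| a b]; [apply: dcval1 | apply: dcvalM].
exists haar; split; [| exact: haar_faithful |]; exists dcinv.
  exact: dcinv_antipode.
by split; [exact: dcinv_antipode | exact: dcinv_anti].
Qed.

End DoubleCosets.

Theorem theorem4p4 (R : realType) (gT : finGroupType) (H : {group gT}) :
  exists Delta : {linear subvs_of (dcalg R[i] H) ->
                         tensor (subvs_of (dcalg R[i] H)) (subvs_of (dcalg R[i] H))},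
    (forall f, tmap vsval vsval (Delta f) =
               tmap (@dcavg R[i] gT H) idfun (gcoprod (vsval f))) /\
    finite_star_quantum_hypergroup Delta (@dcstar R[i] gT H).
Proof.
exists (@dccoprod R[i] gT H); split; first exact: vsval_dccoprod.
exact: dccoprod_finite_star_quantum_hypergroup.
Qed.
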